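(* Let $g\colon\mathbb{R}\to\mathbb{R}$ and suppose there exists a Hamel basis $H\subset\mathbb{R}$ of $\mathbb{R}$ over $\mathbb{Q}$ such that the restriction $g|_{H\cup\{0\}}$ is constant. Then $g$ is a composition of two Hamel functions, i.e. there exist Hamel functions $f,h\colon\mathbb{R}\to\mathbb{R}$ such that $g=h\circ f$.
   Context: A Hamel basis of $\mathbb{R}$ over $\mathbb{Q}$ is a set $H\subset\mathbb{R}$ that is a basis of $\mathbb{R}$ as a linear space over $\mathbb{Q}$. A function $f\colon\mathbb{R}\to\mathbb{R}$ is a Hamel function if its graph $\{\langle x,f(x)\rangle : x\in\mathbb{R}\}\subset\mathbb{R}^2$ is a basis of $\mathbb{R}^2$ as a linear space over $\mathbb{Q}$. *)

(* Defs.v *)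
From HB Require Import structures.
From mathcomp Require Import all_boot all_order all_algebra.
From mathcomp Require Import boolp classical_sets functions reals.
Set Implicit Arguments.
Unset Strict Implicit.
Unset Printing Implicit Defensive.
Import Order.TTheory GRing.Theory Num.Theory.
Local Open Scope classical_set_scope.
Local Open Scope ring_scope.

(* An R-module V is seen as a linear space over the rationals by restricting *)
(* scalars along ratr : rat -> R.                                            *)
Definition rat_comb (R : realType) (V : lmodType R) (s : seq V) (c : V -> rat)
  : V := \sum_(v <- s) ratr (c v) *: v.

Definition rat_free (R : realType) (V : lmodType R) (B : set V) : Prop :=
  forall (s : seq V) (c : V -> rat), uniq s -> [set` s] `<=` B ->
    rat_comb s c = 0 -> forall v, v \in s -> c v = 0.

Definition rat_span (R : realType) (V : lmodType R) (B : set V) : set V :=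
  [set x | exists (s : seq V) (c : V -> rat),
     [/\ uniq s, [set` s] `<=` B & x = rat_comb s c]].

Definition rat_basis (R : realType) (V : lmodType R) (B : set V) : Prop :=
  rat_free B /\ rat_span B = [set: V].

Definition Hamel_basis (R : realType) (H : set R) : Prop :=
  @rat_basis R R^o H.

Definition Hamel_function (R : realType) (f : R -> R) : Prop :=
  @rat_basis R (R^o * R^o)%type [set (x, f x) | x in [set: R]].

(* Main.v *)
(* Fix k in H and let f be k on H u {0} and a bijection from the complement of
   H u {0} onto H \ {k} elsewhere. The differences (b, k) - (0, k), b in H, form
   a basis of R x 0, modulo which the rest of the graph is {0} x H: hence f is a
   Hamel function. Since f is injective where g is not known to be
   constant, g = h o f only prescribes h on H. Take h = L + u, where L is the
   Q-linear map with the prescribed values on H, and u vanishes on H and maps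
   its complement bijectively onto H: the graph of h is the image under the
   shear (x, y) |-> (x, y + L x) of the graph of u, which is a basis.
   The bijections exist because H and its complement have the cardinality of R;
   for H this rests on |A x A| = |A| for infinite A. *)
Require Import Defs.
From mathcomp Require Import all_boot all_order all_algebra.
From mathcomp Require Import boolp classical_sets functions reals.
From mathcomp Require Import cardinality ereal measure lebesgue_measure.
Set Implicit Arguments.
Unset Strict Implicit.
Import Order.TTheory GRing.Theory Num.Theory.
Local Open Scope classical_set_scope.
Local Open Scope ring_scope.
Local Open Scope card_scope.

(** * Cardinal arithmetic: comparability, sums and squares of infinite sets *)

Lemma card_le_fun (T U : Type) (A : set T) (B : set U) : B !=set0 ->
  A #<= B -> exists f : T -> U, (forall x, A x -> B (f x)) /\
    (forall x y, A x -> A y -> f x = f y -> x = y).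
Proof.
elim/Ppointed: U => U in B *; first by rewrite emptyE => -[].
move=> _ /pcard_leP/injfunPex[f fAB finj]; exists f; split=> // x y Ax Ay.
by apply: finj; exact/mem_set.
Qed.

Lemma fun_card_le (T U : Type) (A : set T) (B : set U) (f : T -> U) :
  (forall x, A x -> B (f x)) ->
  (forall x y, A x -> A y -> f x = f y -> x = y) -> A #<= B.
Proof.
elim/Ppointed: U => U in B f *.
  move=> fAB _; suff -> : A = set0 by exact: card_ge0.
  by apply/seteqP; split=> x // /fAB; rewrite emptyE.
move=> fAB finj; apply/pcard_leP/injfunPex; exists f => // x y.
by move=> /set_mem Ax /set_mem Ay; exact: finj.
Qed.

Lemma card_eq_set_bij (T U : Type) (A : set T) (B : set U) : B !=set0 ->
  A #= B -> exists f : T -> U, set_bij A B f.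
Proof.
elim/Ppointed: U => U in B *; first by rewrite emptyE => -[].
by move=> _ /card_set_bijP.
Qed.

(** Zorn's lemma on graphs of partial injections from [A] to [B]: a maximal one is defined on all of
    [A] or reaches all of [B], since otherwise a pair of unmatched points could be added. *)
Lemma card_le_comparable (T U : Type) (A : set T) (B : set U) :
  A #<= B \/ B #<= A.
Proof.
pose P (G : set (T * U)) := [/\ forall p, G p -> A p.1 /\ B p.2,
  forall p q, G p -> G q -> p.1 = q.1 -> p = q &
  forall p q, G p -> G q -> p.2 = q.2 -> p = q].
have [F FP Ftot|M [[MAB M1 M2] Mmax]] := @Zorn_bigcup _ P.
  have two p q : (\bigcup_(X in F) X) p -> (\bigcup_(X in F) X) q ->
      exists X, [/\ F X, X p & X q].
    move=> [X FX Xp] [Y FY Yq]; have [XY|YX] := Ftot _ _ FX FY.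
      by exists Y; split=> //; exact: XY.
    by exists X; split=> //; exact: YX.
  split=> [p [X /FP[+ _ _]]|p q /two/[apply]|p q /two/[apply]]; first exact.
    by move=> -[X [/FP[_ + _]]]; exact.
  by move=> -[X [/FP[_ _]]]; exact.
have [Mdom|/existsNP[a /not_implyP[Aa Ma]]] :=
    pselect (forall a, A a -> exists b, M (a, b)).
  left; have [-> |/set0P[a Aa]] := eqVneq A set0; first exact: card_ge0.
  have [b0 _] := Mdom a Aa.
  have /choice[f fM] : forall x, exists b, A x -> M (x, b).
    move=> x; have [/Mdom[b Mb]|nAx] := pselect (A x); first by exists b.
    by exists b0.
  apply: (@fun_card_le _ _ _ _ f) => [x /fM/MAB[]//|x y /fM Mx /fM My fxy].
  by have [] := M2 _ _ Mx My fxy.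
have [Mran|/existsNP[b /not_implyP[Bb Mb]]] :=
    pselect (forall b, B b -> exists a, M (a, b)).
  right; have /choice[f fM] : forall y, exists x, B y -> M (x, y).
    move=> y; have [/Mran[x Mx]|nBy] := pselect (B y); first by exists x.
    by exists a.
  apply: (@fun_card_le _ _ _ _ f) => [x /fM/MAB[]//|x y /fM Mx /fM My fxy].
  by have [] := M1 _ _ Mx My fxy.
exfalso; apply: (Mmax (M `|` [set (a, b)])).
  split=> [p Mp|/(_ (a, b)) Mab]; first by left.
  by apply: Ma; exists b; apply: Mab; right.
split=> [p [/MAB//|->//]|p q [Mp|->] [Mq|->]//=|p q [Mp|->] [Mq|->]//=].
- exact: M1.
- by case: p Mp => x y /= + xa; rewrite xa => Mp; case: Ma; exists y.
- by case: q Mq => x y /= + xa; rewrite -xa => Mp; case: Ma; exists y.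
- exact: M2.
- by case: p Mp => x y /= + xa; rewrite xa => Mp; case: Mb; exists x.
- by case: q Mq => x y /= + xa; rewrite -xa => Mp; case: Mb; exists x.
Qed.

Lemma card_le_setX (T1 U1 T2 U2 : Type) (A : set T1) (B : set U1) (C : set T2)
    (D : set U2) : A #<= B -> C #<= D -> A `*` C #<= B `*` D.
Proof.
have [-> |/set0P[a Aa]] := eqVneq A set0; first by rewrite set0X card_ge0.
have [-> |/set0P[c Cc]] := eqVneq C set0; first by rewrite setX0 card_ge0.
have [-> |/set0P B0] := eqVneq B set0.
  by move=> /card_le0P A0; move: Aa; rewrite A0.
have [-> |/set0P D0] := eqVneq D set0.
  by move=> _ /card_le0P C0; move: Cc; rewrite C0.
move=> /(card_le_fun B0)[f [fAB fI]] /(card_le_fun D0)[g [gCD gI]].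
apply: (@fun_card_le _ _ _ _ (fun p => (f p.1, g p.2))).
  by move=> p [/fAB ? /gCD ?].
by move=> [x y] [x' y'] [/= ? ?] [/= ? ?] [/fI-> // /gI->].
Qed.

Lemma infinite_ex2 (T : Type) (A : set T) : infinite_set A ->
  exists a b, [/\ A a, A b & a <> b].
Proof.
move=> Ainf; have [a Aa] := infinite_setN0 Ainf.
have [b [Ab nba]] := infinite_setN0 (infinite_setD Ainf (finite_set1 a)).
by exists b, a; split.
Qed.

(** Two distinct points [c] and [d] of [C] serve as tags: points of [A] go to [C] x {[c]}, the
    others to [C] x {[d]}. *)
Lemma card_le_setU (T U : Type) (A B : set T) (C : set U) : infinite_set C ->
  C `*` C #<= C -> A #<= C -> B #<= C -> A `|` B #<= C.
Proof.
move=> Cinf CC; have [c [d [Cc Cd cd]]] := infinite_ex2 Cinf.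
have C0 : C !=set0 by exists c.
move=> /(card_le_fun C0)[f [fA fI]] /(card_le_fun C0)[g [gB gI]].
apply: card_le_trans CC.
apply: (@fun_card_le _ _ _ _
  (fun x => if pselect (A x) then (f x, c) else (g x, d))).
  move=> x ABx; case: pselect => [Ax|nAx]; split=> //=; first exact: fA.
  by apply: gB; case: ABx.
move=> x y ABx ABy; case: pselect => Ax; case: pselect => Ay -[].
- exact: fI.
- by [].
- by move=> _ /esym.
- by apply: gI; [case: ABx|case: ABy].
Qed.

(* Zorn's lemma on the graphs of injections D x D -> D with D included in A,
   enlarged by the graph G0 of such an injection for a countable D. If D is
   maximal and D injects into A \ D, with image C, then the injection extends
   to (D u C) x (D u C), the new pairs going to C; so A \ D injects into D. *)
Lemma card_infinite_setX (T : Type) (A : set T) :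
  infinite_set A -> A `*` A #<= A.
Proof.
move=> Ainf; have A0 := infinite_setN0 Ainf.
have [e [eA eI]] : exists e : nat -> T, (forall n, A (e n)) /\ injective e.
  move/infiniteP: (Ainf) => /(card_le_fun A0)[e [eA eI]].
  by exists e; split=> [n|m n]; [exact: eA|exact: eI].
(* For the graph [G] of a map on D x D, the set D is recovered from the diagonal pairs that have a
   value. *)
pose D (G : set ((T * T) * T)) := [set x | exists y, G ((x, x), y)].
pose P (G : set ((T * T) * T)) := [/\ D G `<=` A,
  forall p, G p -> [/\ D G p.1.1, D G p.1.2 & D G p.2],
  forall a b, D G a -> D G b -> exists y, G ((a, b), y),
  forall p q, G p -> G q -> p.1 = q.1 -> p = q &
  forall p q, G p -> G q -> p.2 = q.2 -> p = q].
have Pbig (F : set (set ((T * T) * T))) : F `<=` P -> total_on F subset ->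
    P (\bigcup_(X in F) X).
  move=> FP Ftot.
  have two p q : (\bigcup_(X in F) X) p -> (\bigcup_(X in F) X) q ->
      exists X, [/\ F X, X p & X q].
    move=> [X FX Xp] [Y FY Yq]; have [XY|YX] := Ftot _ _ FX FY.
      by exists Y; split=> //; exact: XY.
    by exists X; split=> //; exact: YX.
  have DF X x : F X -> D X x -> D (\bigcup_(X in F) X) x.
    by move=> FX [y Xy]; exists y, X.
  split.
  - by move=> x [y [X /[dup] FX /FP[XA _ _ _ _] Xy]]; apply: XA; exists y.
  - move=> p [X /[dup] FX /FP[_ XD _ _ _]] /XD[? ? ?].
    by split; apply: (DF X).
  - move=> a b [y Fy] [z Fz]; have [X [FX Xy Xz]] := two _ _ Fy Fz.
    have [_ _ /(_ a b) XX _ _] := FP _ FX.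
    have [||w Xw] := XX; [by exists y|by exists z|].
    by exists w, X.
  - by move=> p q /two/[apply] -[X [/FP[_ _ _ + _]]]; exact.
  - by move=> p q /two/[apply] -[X [/FP[_ _ _ _]]]; exact.
pose G0 : set ((T * T) * T) :=
  [set p | exists i j : nat, p = ((e i, e j), e (pickle (i, j)))].
have D0 : D G0 = range e.
  apply/seteqP; split=> [x [y [i [j [-> _ _]]]]|_ [i _ <-]]; first by exists i.
  by exists (e (pickle (i, i))), i, i.
have PG0 : P G0.
  rewrite /P D0; split.
  - by move=> _ [i _ <-].
  - by move=> _ [i [j ->]]; split=> /=; apply: imageT.
  - by move=> _ _ [i _ <-] [j _ <-]; exists (e (pickle (i, j))), i, j.
  - by move=> _ _ [i [j ->]] [k [l ->]] /= [/eI-> /eI->].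
  - by move=> _ _ [i [j ->]] [k [l ->]] /= /eI/(pcan_inj pickleK)[-> ->].
(* Adjoining [G0] inside the predicate forces the maximal relation to contain it, so that its domain
   is infinite. The union is then rewritten as that of a chain with [G0] as a member, to which
   [Pbig] applies. *)
have [F FP Ftot|M [MP Mmax]] := @Zorn_bigcup _ (fun G => P (G0 `|` G)).
  have -> : G0 `|` \bigcup_(X in F) X =
      \bigcup_(X in G0 |` [set G0 `|` X | X in F]) X.
    apply/seteqP; split=> [p [G0p|[X FX Xp]]|p [X [->|[Y FY <-]] ]].
    - by exists G0; [left|].
    - by exists (G0 `|` X); [right; exists X|right].
    - by left.
    - by move=> [|Yp]; [left|right; exists Y].
  apply: Pbig => [X [->//|[Y /FP ? <-//]]|X Y [->|[X' FX <-]] [->|[Y' FY <-]]].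
  - by left.
  - by left; left.
  - by right; left.
  - by have [XY|YX] := Ftot _ _ FX FY; [left|right]; exact: setUS.
move: MP; set N := G0 `|` M => -[NA ND NN N1 N2].
have {}Nmax G : P G -> N `<=` G -> G `<=` N.
  move=> PG NG; apply: contrapT => nGN; apply: (Mmax G).
    split=> [p Mp|GM]; first by apply: NG; right.
    by apply: nGN => p Gp; right; exact: GM.
  suff -> : G0 `|` G = G by [].
  by apply/setUidPr => p G0p; apply: NG; left.
set B := D N in NA ND NN *.
have eB n : B (e n) by exists (e (pickle (n, n))); left; exists n, n.
have Binf : infinite_set B.
  by apply/infiniteP; apply: (@fun_card_le _ _ _ _ e) => // m n _ _; exact: eI.
have BB : B `*` B #<= B.
  have /choice[f fN] : forall p, exists y, (B `*` B) p -> N (p, y).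
    move=> [a b]; have [[Ba Bb]|nab] := pselect ((B `*` B) (a, b)).
      by have [y Ny] := NN _ _ Ba Bb; exists y.
    by exists (e 0%N).
  apply: (@fun_card_le _ _ _ _ f) => [p /fN/ND[]//|p q /fN Np /fN Nq pq].
  by have [] := N2 _ _ Np Nq pq.
have AE : A = B `|` (A `\` B).
  apply/seteqP; split=> [x Ax|x [/NA//|[]//]].
  by have [] := pselect (B x); [left|right].
(* If [A] minus [B] injects into [B], then so does [A], and A x A <= B x B <= B <= A. *)
have [AB|BA] := card_le_comparable (A `\` B) B.
  have {}AB : A #<= B by rewrite AE; exact: card_le_setU.
  apply: card_le_trans (card_le_setX AB AB) _.
  exact: card_le_trans BB (subset_card_le NA).
exfalso.
have [|f [fB fI]] := card_le_fun _ BA.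
  apply: contrapT => /set0P/negP/negPn/eqP AB0; move: BA; rewrite AB0.
  by move=> /card_le0P B0; move: (eB 0%N); rewrite B0.
pose C := f @` B.
have CB : C #<= B by exact: card_image_le.
have BCB := card_le_setU Binf BB (card_lexx B) CB.
have BC2 : (B `|` C) `*` (B `|` C) #<= B.
  exact: card_le_trans (card_le_setX BCB BCB) BB.
have [|t [tB tI]] := card_le_fun _ BC2; first by exists (e 0%N).
(* On the new pairs the map is [f] after [t]: it is injective, and its values in [C] avoid the old
   values, which lie in [B]. *)
pose G := N `|` [set p | [/\ (B `|` C) p.1.1, (B `|` C) p.1.2,
  ~ (B `*` B) p.1 & p.2 = f (t p.1)]].
have nBC x : B x -> C x -> False by move=> Bx [y /fB[_ +] yx]; rewrite yx.
have DG : D G = B `|` C.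
  apply/seteqP; split=> [x [y [Nxy|[]//]]|x [[y Nxy]|Cx]].
  - by left; exists y.
  - by exists y; left.
  - by exists (f (t (x, x))); right; split; [right|right|move=> [/nBC]|].
(* By maximality [G] would be part of [N]; its value at the diagonal pair of [f (e 0)] would then
   put this point of [C] in [B], which is disjoint from [C]. *)
suff PG : P G.
  have fe : C (f (e 0%N)) by exists (e 0%N).
  apply: (nBC (f (e 0%N)) _ fe).
  exists (f (t (f (e 0%N), f (e 0%N)))); apply: (Nmax G PG) => [p Np|].
    by left.
  by right; split=> //=; [right|right|move=> [/nBC]].
have NBB p : N p -> (B `*` B) p.1 by move=> /ND[].
rewrite /P DG; split.
- by move=> x [/NA//|[y By <-]]; have [] := fB _ By.
- move=> p [/ND[? ? ?]|[? ? _ ->]]; first by split; left.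
  by split=> //; right; exists (t p.1) => //; exact: tB.
- move=> a b BCa BCb; have [[Ba Bb]|nBB] := pselect ((B `*` B) (a, b)).
    by have [y Ny] := NN _ _ Ba Bb; exists y; left.
  by exists (f (t (a, b))); right.
- move=> p q [Np|[? ? nBp ?]] [Nq|[? ? nBq ?]] pq.
  + exact: N1.
  + by case: nBq; rewrite -pq; exact: NBB.
  + by case: nBp; rewrite pq; exact: NBB.
  + by rewrite [p]surjective_pairing [q]surjective_pairing; congruence.
- move=> p q [Np|[p1 p2 nBp pE]] [Nq|[q1 q2 nBq qE]] pq.
  + exact: N2.
  + exfalso; apply: (@nBC p.2); first by have [] := ND _ Np.
    by rewrite pq qE; exists (t q.1) => //; exact: tB.
  + exfalso; apply: (@nBC q.2); first by have [] := ND _ Nq.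
    by rewrite -pq pE; exists (t p.1) => //; exact: tB.
  + have p1q1 : p.1 = q.1.
      by apply: tI => //; apply: fI; rewrite -?pE -?qE //; apply: tB.
    by rewrite [p]surjective_pairing [q]surjective_pairing p1q1 pq.
Qed.

(** Countable sets have Lebesgue measure 0, whereas the unit interval has measure 1. *)
Lemma realType_uncountable (R : realType) : ~ countable [set: R].
Proof.
move=> /(sub_countable (subset_card_le (@subsetT _ `[0%R, 1%R]))).
move=> /countable_lebesgue_measure0 /eqP.
by rewrite lebesgue_measure_itv /= lte_fin ltr01 oppr0 adde0 eqe oner_eq0.
Qed.

(** * Linear algebra over the rationals *)

Section RationalLinearAlgebra.
Variable R : realType.
Implicit Types V W : lmodType R.

(** Homogeneity is asked for rational scalars only: coordinate maps of a Hamel basis need not be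
    [R]-linear. *)
Definition rat_linear V W (L : V -> W) : Prop :=
  (forall x y, L (x + y) = L x + L y) /\
  (forall (q : rat) x, L (ratr q *: x) = ratr q *: L x).

Lemma rat_linear_sum V W (L : V -> W) (I : Type) (s : seq I) (c : I -> rat)
    (e : I -> V) : rat_linear L ->
  L (\sum_(i <- s) ratr (c i) *: e i) = \sum_(i <- s) ratr (c i) *: L (e i).
Proof.
move=> [LD LZ]; elim: s => [|i s IH]; last by rewrite !big_cons LD LZ IH.
rewrite !big_nil -[0 in LHS](scale0r 0) -(rmorph0 (@ratr R)).
by rewrite LZ rmorph0 scale0r.
Qed.

Lemma rat_linear0 V W (L : V -> W) : rat_linear L -> L 0 = 0.
Proof. by move=> [_ /(_ 0 0)]; rewrite rmorph0 !scale0r. Qed.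

(** Padding with zero coefficients brings combinations with different supports to a common one. *)
Lemma sum_subseq V W (F : V -> W) (s t : seq V) (c : V -> rat) :
  uniq s -> uniq t -> {subset s <= t} ->
  \sum_(v <- s) ratr (c v) *: F v =
  \sum_(v <- t) ratr (if v \in s then c v else 0) *: F v.
Proof.
move=> us ut st.
rewrite [RHS](bigID [in s]) /= [X in _ + X]big1 ?addr0; last first.
  by move=> v /negPf ->; rewrite rmorph0 scale0r.
rewrite -[RHS]big_filter [RHS](perm_big s) /=.
  by apply: eq_big_seq => v ->.
apply: uniq_perm; rewrite ?filter_uniq // => v.
by rewrite mem_filter andb_idr //; exact: st.
Qed.

(** Over the union of the supports, freeness makes the padded coefficients agree. This is the
    well-definedness of the linear extension of [F]. *)
Lemma rat_free_sum V W (B : set V) (F : V -> W) (s t : seq V) (c d : V -> rat) :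
  rat_free B -> uniq s -> uniq t -> [set` s] `<=` B -> [set` t] `<=` B ->
  rat_comb s c = rat_comb t d ->
  \sum_(v <- s) ratr (c v) *: F v = \sum_(v <- t) ratr (d v) *: F v.
Proof.
move=> Bfree us ut sB tB std; pose u := undup (s ++ t).
have uu : uniq u by exact: undup_uniq.
have su : {subset s <= u} by move=> v vs; rewrite mem_undup mem_cat vs.
have tu : {subset t <= u} by move=> v vt; rewrite mem_undup mem_cat vt orbT.
rewrite (sum_subseq F c us uu su) (sum_subseq F d ut uu tu).
apply: eq_big_seq => v vu; congr (ratr _ *: _); apply/eqP.
rewrite -subr_eq0; apply/eqP.
apply: (Bfree u (fun v => (if v \in s then c v else 0) -
  (if v \in t then d v else 0))) => //.
  by move=> w; rewrite /= mem_undup mem_cat => /orP[/sB|/tB].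
move: std; rewrite /rat_comb (sum_subseq id c us uu su).
rewrite (sum_subseq id d ut uu tu) => /eqP; rewrite -subr_eq0 -sumrB.
by move=> /eqP; under eq_bigr do rewrite -scalerBl -rmorphB.
Qed.

(** The coefficients [e] are chosen before [G], so the same ones express a sum of vectors ([G] the
    identity) and the sum of their images. *)
Lemma rat_sum_merge V (s t : seq V) (c d : V -> rat) : uniq s -> uniq t ->
  exists u e, [/\ uniq u, u =i s ++ t & forall W (G : V -> W),
    \sum_(v <- s) ratr (c v) *: G v + \sum_(v <- t) ratr (d v) *: G v =
    \sum_(v <- u) ratr (e v) *: G v].
Proof.
move=> us ut; pose u := undup (s ++ t).
have uu : uniq u by exact: undup_uniq.
have su : {subset s <= u} by move=> v vs; rewrite mem_undup mem_cat vs.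
have tu : {subset t <= u} by move=> v vt; rewrite mem_undup mem_cat vt orbT.
exists u,
  (fun v => (if v \in s then c v else 0) + (if v \in t then d v else 0)).
split=> // [v|W G]; first by rewrite mem_undup.
rewrite (sum_subseq G c us uu su) (sum_subseq G d ut uu tu) -big_split /=.
by apply: eq_bigr => v _; rewrite rmorphD scalerDl.
Qed.

(** [L] is computed from a chosen representation of each vector; by [rat_free_sum] any other
    representation gives the same value ([LE]), whence linearity. *)
Lemma rat_basis_extend V W (B : set V) (F : V -> W) : rat_basis B ->
  exists L : V -> W, rat_linear L /\ (forall b, B b -> L b = F b).
Proof.
move=> [Bfree Bspan].
have /choice[S /choice[C SC]] : forall x, exists s, exists c : V -> rat,
    [/\ uniq s, [set` s] `<=` B & x = rat_comb s c].
  by move=> x; have : rat_span B x by rewrite Bspan.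
pose L x := \sum_(v <- S x) ratr (C x v) *: F v.
have LE t d : uniq t -> [set` t] `<=` B ->
    L (rat_comb t d) = \sum_(v <- t) ratr (d v) *: F v.
  move=> ut tB; have [uS SB xE] := SC (rat_comb t d).
  by apply: (@rat_free_sum _ _ B).
exists L; split; last first.
  move=> b Bb; have := LE [:: b] (fun=> 1) isT.
  rewrite /rat_comb !big_seq1 rmorph1 !scale1r; apply=> v /=.
  by rewrite inE => /eqP ->.
split=> [x y|q x].
  have [ux xB xE] := SC x; have [uy yB yE] := SC y.
  have [u [d [uu uE sumE]]] := rat_sum_merge (C x) (C y) ux uy.
  have -> : x + y = rat_comb u d.
    by rewrite {1}xE {1}yE; exact: (sumE _ id).
  rewrite LE // -?sumE // => v /=.
  by rewrite uE mem_cat => /orP[/xB|/yB].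
have [ux xB xE] := SC x.
have -> : ratr q *: x = rat_comb (S x) (fun v => q * C x v).
  rewrite {1}xE /rat_comb scaler_sumr; apply: eq_bigr => v _.
  by rewrite rmorphM scalerA.
rewrite LE // scaler_sumr; apply: eq_bigr => v _.
by rewrite rmorphM scalerA.
Qed.

Lemma rat_spanP V (B : set V) : [/\ B `<=` rat_span B, rat_span B 0,
  forall x y, rat_span B x -> rat_span B y -> rat_span B (x + y) &
  forall q x, rat_span B x -> rat_span B (ratr q *: x)].
Proof.
split.
- move=> b Bb; exists [:: b], (fun=> 1); split=> // [v /=|].
    by rewrite inE => /eqP ->.
  by rewrite /rat_comb big_seq1 rmorph1 scale1r.
- by exists [::], (fun=> 0); split=> //; rewrite /rat_comb big_nil.
- move=> _ _ [s [c [us sB ->]]] [t [d [ut tB ->]]].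
  have [u [e [uu uE sumE]]] := rat_sum_merge c d us ut.
  exists u, e; split=> // [v /=|]; last exact: (sumE _ id).
  by rewrite uE mem_cat => /orP[/sB|/tB].
- move=> q _ [s [c [us sB ->]]]; exists s, (fun v => q * c v); split=> //.
  rewrite /rat_comb scaler_sumr; apply: eq_bigr => v _.
  by rewrite rmorphM scalerA.
Qed.

Lemma rat_spanB V (B : set V) x y :
  rat_span B x -> rat_span B y -> rat_span B (x - y).
Proof.
have [_ _ BD BZ] := rat_spanP B.
by move=> Bx /(BZ (-1)); rewrite rmorphN1 scaleN1r; exact: BD.
Qed.

Lemma rat_span_ind V W (B : set V) (C : set W) (T : V -> W) :
  rat_span B = setT -> rat_linear T -> (forall b, B b -> rat_span C (T b)) ->
  forall x, rat_span C (T x).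
Proof.
move=> Bspan Tlin TB x; have [_ C0 CD CZ] := rat_spanP C.
have [s [c [_ sB ->]]] : rat_span B x by rewrite Bspan.
rewrite (@rat_linear_sum _ _ T) //.
elim: s sB => [|v s IH] sB; first by rewrite big_nil.
rewrite big_cons; apply: CD; first by apply/CZ/TB/sB; rewrite /= inE eqxx.
by apply: IH => w ws; apply: sB; rewrite /= inE ws orbT.
Qed.

End RationalLinearAlgebra.

(** * Cardinality of a Hamel basis and of its complement *)

(** A vector is encoded by its list of basis vectors, folded into one point of [Z] by an injection
    [p] of Z x Z into [Z], and by its list of rational coefficients, pickled to a natural number and
    embedded in [Z]. *)
Lemma card_rat_basis_le (R : realType) (V : lmodType R) (B : set V) (U : Type)
    (Z : set U) : rat_basis B -> infinite_set Z -> B #<= Z -> [set: V] #<= Z.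
Proof.
move=> [_ Bspan] Zinf; have Z0 := infinite_setN0 Zinf; have [z0 Zz0] := Z0.
move=> /(card_le_fun Z0)[i [iZ iI]].
have /(card_le_fun Z0)[p [pZ pI]] := card_infinite_setX Zinf.
have pI2 a b a' b' : Z a -> Z b -> Z a' -> Z b' -> p (a, b) = p (a', b') ->
    a = a' /\ b = b'.
  by move=> ? ? ? ? /pI E; have [] : (a, b) = (a', b') by exact: E.
have /(card_le_fun Z0)[n [nZ nI]] := (infiniteP Z).1 Zinf.
have /choice[S /choice[C SC]] : forall x, exists s, exists c : V -> rat,
    [/\ uniq s, [set` s] `<=` B & x = rat_comb s c].
  by move=> x; have : rat_span B x by rewrite Bspan.
pose enc (s : seq V) := foldr (fun v z => p (i v, z)) z0 s.
have encZ s : [set` s] `<=` B -> Z (enc s).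
  elim: s => //= v s IH sB; apply: pZ; split=> /=.
    by apply/iZ/sB; rewrite /= inE eqxx.
  by apply: IH => w ws; apply: sB; rewrite /= inE ws orbT.
(* The end marker [z0] may itself be a value of [p], so equal lengths are assumed; they will follow
   from the equality of the coefficient lists. *)
have encI s t : size s = size t -> [set` s] `<=` B -> [set` t] `<=` B ->
    enc s = enc t -> s = t.
  elim: s t => [[]//|v s IH [//|w t]] /= [st] vsB wtB.
  have sB : [set` s] `<=` B by move=> x xs; apply: vsB; rewrite /= inE xs orbT.
  have tB : [set` t] `<=` B by move=> x xt; apply: wtB; rewrite /= inE xt orbT.
  have Bv : B v by apply: vsB; rewrite /= inE eqxx.
  have Bw : B w by apply: wtB; rewrite /= inE eqxx.
  move=> /(pI2 _ _ _ _ (iZ _ Bv) (encZ _ sB) (iZ _ Bw) (encZ _ tB)).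
  by move=> [/iI-> // /IH->] //; case: st.
apply: (@fun_card_le _ _ _ _
  (fun x => p (enc (S x), n (pickle (map (C x) (S x)))))).
  move=> x _; have [_ sB _] := SC x.
  by apply: pZ; split; [exact: encZ|exact: nZ].
move=> x y _ _; have [_ xB xE] := SC x; have [_ yB yE] := SC y.
move=> /(pI2 _ _ _ _ (encZ _ xB) (nZ _ I) (encZ _ yB) (nZ _ I)).
move=> [Exy /(nI _ _ I I)/(pcan_inj pickleK) Cxy].
have Sxy : S x = S y.
  by apply: encI => //; have := congr1 size Cxy; rewrite !size_map.
rewrite xE yE /rat_comb -Sxy; apply: eq_big_seq => v vS.
by congr (ratr _ *: _); move: v vS; apply/eq_in_map; rewrite Cxy Sxy.
Qed.

(** A finite basis would inject into the natural numbers, and then so would [R]. *)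
Lemma Hamel_basis_infinite (R : realType) (H : set R) :
  Hamel_basis H -> infinite_set H.
Proof.
move=> Hbasis /finite_set_countable Hcount; apply: (@realType_uncountable R).
exact: card_rat_basis_le Hbasis infinite_nat Hcount.
Qed.

Section HamelFunctions.
Variables (R : realType) (H : set R).
Hypothesis Hbasis : Hamel_basis H.

Let card_real_le_Hamel : [set: R] #<= H.
Proof.
exact: card_rat_basis_le Hbasis (Hamel_basis_infinite Hbasis) (card_lexx H).
Qed.

(** [H] is covered by the infinite set [H] minus [k] and one point, which that set absorbs. *)
Lemma card_setD1_Hamel (k : R) : H `\ k #= H.
Proof.
have Hinf := Hamel_basis_infinite Hbasis.
apply: Cantor_Bernstein; first exact: card_le_setD.
have Zinf := infinite_setD Hinf (finite_set1 k).
have [z Zz] := infinite_setN0 Zinf.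
apply: card_le_trans (subset_card_le _)
  (card_le_setU Zinf (card_infinite_setX Zinf) (card_lexx _)
    (_ : [set k] #<= _)).
  by move=> x Hx; have [xk|xk] := pselect (x = k); [right|left].
by apply: (@fun_card_le _ _ _ _ (fun=> z)) => // x y -> ->.
Qed.

(* Doubling maps H into the complement of H u {0}. *)
Lemma card_setC_Hamel (A : set R) : A `<=` H `|` [set 0] -> ~` A #= H.
Proof.
move=> AH; apply: Cantor_Bernstein.
  exact: card_le_trans (subset_card_le (@subsetT _ _)) card_real_le_Hamel.
apply: (@fun_card_le _ _ _ _ (fun x : R => ratr 2 * x)); last first.
  by move=> x y _ _; apply: mulfI; rewrite fmorph_eq0.
(* A linear [L] equal to 1 on [H] separates: it is 2 at the double of a point of [H], but 1 on [H]
   and 0 at 0. *)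
have [L [Llin L1]] := @rat_basis_extend R R^o R^o H (fun=> 1) Hbasis.
move=> x Hx /AH Hx2; have LE : L (ratr 2 * x) = ratr 2.
  by rewrite -[RHS]mulr1 -(L1 _ Hx); exact: Llin.2.
have : ratr 2 = 1 :> R \/ ratr 2 = 0 :> R.
  case: Hx2 => [/L1|/= x0]; first by rewrite LE; left.
  by right; rewrite -LE x0; exact: rat_linear0 Llin.
by case=> /eqP; rewrite ?fmorph_eq1 ?fmorph_eq0.
Qed.

(** * Criteria for Hamel functions *)

(** A graph point is determined by its abscissa, so relations among graph points can be indexed by
    reals and split into coordinates. For spanning, the two axes suffice, and each is generated by
    the copy of [H] on it. *)
Lemma Hamel_function_of (f : R -> R) :
  (forall s (c : R -> rat), uniq s ->
     \sum_(x <- s) ratr (c x) * x = 0 -> \sum_(x <- s) ratr (c x) * f x = 0 ->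
     forall x, x \in s -> c x = 0) ->
  (forall b, H b ->
     let S := @rat_span R (R^o * R^o)%type [set (x, f x) | x in setT] in
     S (b, 0) /\ S (0, b)) ->
  Hamel_function f.
Proof.
move=> ffree fspan; split; last first.
  apply/seteqP; split=> // -[x y] _.
  have [_ _ spanD _] :=
    @rat_spanP R (R^o * R^o)%type [set (x, f x) | x in setT].
  have -> : (x, y) = (x, 0) + (0, y) :> R^o * R^o.
    by congr pair; rewrite /= ?addr0 ?add0r.
  have [_ Hspan] := Hbasis; apply: spanD.
    apply: (@rat_span_ind R R^o (R^o * R^o)%type H _ (fun x => (x, 0))) => //.
      by split=> [u v|q u]; congr pair; rewrite /= ?addr0 ?scaler0.
    by move=> b /fspan[].
  apply: (@rat_span_ind R R^o (R^o * R^o)%type H _ (fun x => (0, x))) => //.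
    by split=> [u v|q u]; congr pair; rewrite /= ?addr0 ?scaler0.
  by move=> b /fspan[].
move=> s c us sB s0 v vs.
have sE w : w \in s -> w = (w.1, f w.1) by move=> /sB[x _ <-].
have [x _ xv] := sB _ vs.
pose t := map fst s.
have ut : uniq t.
  by rewrite map_inj_in_uniq // => u w /sE -> /sE -> /= ->.
have sumE (G : R^o * R^o -> R) (F : R -> R) : (forall x, G (x, f x) = F x) ->
    \sum_(w <- s) ratr (c w) * G w = \sum_(x <- t) ratr (c (x, f x)) * F x.
  move=> GF; rewrite big_map; apply: eq_big_seq => w /sE ws.
  by rewrite -GF -ws.
have fstL : rat_linear (fst : R^o * R^o -> R^o) by split.
have sndL : rat_linear (snd : R^o * R^o -> R^o) by split.
rewrite -xv; apply: (ffree t (fun x => c (x, f x))) => //.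
- rewrite -(sumE fst id) //.
  by rewrite -[LHS](rat_linear_sum s c id fstL) [X in fst X]s0.
- rewrite -(sumE snd f) //.
  by rewrite -[LHS](rat_linear_sum s c id sndL) [X in snd X]s0.
- by apply/mapP; exists v; rewrite // -xv.
Qed.

(** The coordinate functionals of [H]. Applied to a vanishing combination, they isolate single
    coefficients through [sum_single_eq0]. *)
Lemma Hamel_basis_dual : exists lam : R -> R -> R,
  (forall b, rat_linear (lam b : R^o -> R^o)) /\
  (forall b b', H b' -> lam b b' = (b' == b)%:R).
Proof.
have /choice[lam lamP] : forall b, exists l : R -> R,
    rat_linear (l : R^o -> R^o) /\ forall b', H b' -> l b' = (b' == b)%:R.
  move=> b.
  exact: (@rat_basis_extend R R^o R^o H (fun b' => (b' == b)%:R) Hbasis).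
by exists lam; split=> b; have [] := lamP b.
Qed.

Lemma sum_single_eq0 (s : seq R) (c : R -> rat) (G : R -> R) (x : R) :
  uniq s -> x \in s -> \sum_(y <- s) ratr (c y) * G y = 0 -> G x <> 0 ->
  (forall y, y \in s -> y <> x -> c y = 0 \/ G y = 0) -> c x = 0.
Proof.
move=> us xs + Gx cG; rewrite (bigD1_seq x) //= big_seq_cond big1 ?addr0.
  by move=> /eqP; rewrite mulf_eq0 fmorph_eq0 => /orP[/eqP|/eqP].
move=> y /andP[ys /eqP yx]; case: (cG y ys yx) => ->.
  by rewrite rmorph0 mul0r.
by rewrite mulr0.
Qed.

Lemma rat_linear_eq0 (L : R -> R) (s : seq R) (c : R -> rat) (G : R -> R) :
  rat_linear (L : R^o -> R^o) -> \sum_(y <- s) ratr (c y) * G y = 0 ->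
  \sum_(y <- s) ratr (c y) * L (G y) = 0.
Proof.
move=> Llin s0; rewrite -[LHS](@rat_linear_sum R R^o R^o L R s c G) //.
by rewrite [X in L X]s0; exact: rat_linear0 Llin.
Qed.

Lemma Hamel_function_collapse (k : R) (beta f : R -> R) : H k ->
  set_bij (~` (H `|` [set 0])) (H `\ k) beta ->
  (forall x, (H `|` [set 0]) x -> f x = k) ->
  (forall x, ~ (H `|` [set 0]) x -> f x = beta x) -> Hamel_function f.
Proof.
move=> Hk [betaH betaI betaS] fk fb.
have [lam [lamlin lamH]] := Hamel_basis_dual.
have lam0 b : lam b 0 = 0 by exact: rat_linear0 (lamlin b).
have lam1 b : H b -> lam b b <> 0.
  by move=> Hb; rewrite lamH // eqxx; apply/eqP/oner_neq0.
have fH x : H (f x).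
  by have [/fk->//|/[dup] /fb-> /betaH[]] := pselect ((H `|` [set 0]) x).
apply: Hamel_function_of => [s c us s1 s2|b Hb S].
(* Coefficients are eliminated in three rounds. First, off [H] and 0: there [f x] differs from [k]
   and is taken at [x] only, so its coordinate in the second relation isolates [c x]. *)
- have cC x : x \in s -> ~ (H `|` [set 0]) x -> c x = 0.
    move=> xs nx.
    apply: (sum_single_eq0 us xs (rat_linear_eq0 (lamlin (f x)) s2)).
      exact: lam1.
    move=> y ys yx; right; rewrite lamH //; case: eqP => // fyx.
    exfalso; apply: yx.
    have [betax nbetax] := betaH _ nx.
    have ny : ~ (H `|` [set 0]) y.
      by move=> /fk fy; apply: nbetax; rewrite /= -fy fyx fb.
    by apply: betaI; rewrite ?inE // -!fb.
  (* Second, on [H]: the coordinate along [x] in the first relation, where 0 contributes nothing. *)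
  have cH x : x \in s -> H x -> c x = 0.
    move=> xs Hx; apply: (sum_single_eq0 us xs (rat_linear_eq0 (lamlin x) s1)).
      exact: lam1.
    move=> y ys yx; have [[Hy|/= ->]|ny] := pselect ((H `|` [set 0]) y).
    + by right; rewrite lamH //; case: eqP.
    + by right.
    + by left; exact: cC.
  move=> x xs; have [[Hx|/= x0]|nx] := pselect ((H `|` [set 0]) x).
  + exact: cH.
  (* Third, at 0: the second relation is reduced to the term with [f 0 = k], and [k] is nonzero as a
     basis element. *)
  + apply: (sum_single_eq0 us xs s2).
      rewrite fk; last by right.
      by move=> k0; apply: (lam1 k Hk); rewrite {2}k0.
    move=> y ys; rewrite x0 => y0; left.
    by have [Hy|nHy] := pselect (H y); [exact: cH|apply: cC => // -[]].
  + exact: cC.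
have [_ Hspan] := Hbasis.
have [subS _ _ _] := @rat_spanP R (R^o * R^o)%type [set (x, f x) | x in setT].
have Sf x : S (x, f x) by apply: subS; exists x.
have S1 x : H x -> S (x, 0).
  move=> Hx; have := rat_spanB (Sf x) (Sf 0).
  rewrite !fk; [|by right|by left].
  by congr S; congr pair; rewrite /= ?subr0 ?subrr.
have S1T x : S (x, 0).
  apply: (@rat_span_ind R R^o (R^o * R^o)%type H _ (fun x => (x, 0))) => //.
  by split=> [v w|q v]; congr pair; rewrite /= ?addr0 ?scaler0.
split=> //.
have [bk|bk] := pselect (b = k).
  by rewrite bk -(fk 0); [exact: Sf|right].
have [x nx <-] := betaS b (conj Hb bk).
have := rat_spanB (Sf x) (S1T x); rewrite fb //.
by congr S; congr pair; rewrite /= ?subr0 ?subrr.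
Qed.

Lemma Hamel_function_shear (L u h : R -> R) : rat_linear (L : R^o -> R^o) ->
  set_bij (~` H) H u -> (forall x, H x -> h x = L x) ->
  (forall x, ~ H x -> h x = L x + u x) -> Hamel_function h.
Proof.
move=> Llin [uH uI uS] hH hC.
have [lam [lamlin lamH]] := Hamel_basis_dual.
have lam0 b : lam b 0 = 0 by exact: rat_linear0 (lamlin b).
have lam1 b : H b -> lam b b <> 0.
  by move=> Hb; rewrite lamH // eqxx; apply/eqP/oner_neq0.
apply: Hamel_function_of => [s c us s1 s2|b Hb S].
(* Subtracting [L] of the first relation undoes the shear: [h x - L x] is 0 on [H] and [u x]
   elsewhere. *)
- have s3 : \sum_(x <- s) ratr (c x) * (h x - L x) = 0.
    under eq_bigr do rewrite mulrBr.
    by rewrite sumrB s2 (rat_linear_eq0 (G := id) Llin s1) subrr.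
  have cC x : x \in s -> ~ H x -> c x = 0.
    move=> xs nx.
    apply: (sum_single_eq0 us xs (rat_linear_eq0 (lamlin (u x)) s3)).
      by rewrite hC // addrC addKr; apply/lam1/uH.
    move=> y ys yx; right; have [Hy|ny] := pselect (H y).
      by rewrite hH // subrr lam0.
    rewrite hC // addrC addKr lamH; last exact: uH.
    by case: eqP => // uyx; exfalso; apply: yx; apply: uI; rewrite ?inE.
  move=> x xs; have [Hx|nx] := pselect (H x); last exact: cC.
  apply: (sum_single_eq0 us xs (rat_linear_eq0 (lamlin x) s1)).
    exact: lam1.
  move=> y ys yx; have [Hy|ny] := pselect (H y); last by left; exact: cC.
  by right; rewrite lamH //; case: eqP.
have [_ Hspan] := Hbasis.
have [subS _ _ _] := @rat_spanP R (R^o * R^o)%type [set (x, h x) | x in setT].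
have Sh x : S (x, h x) by apply: subS; exists x.
(* The graph of [L] is spanned by its points over [H], where [h] and [L] agree. *)
have SL x : S (x, L x).
  apply: (@rat_span_ind R R^o (R^o * R^o)%type H _ (fun x => (x, L x))) => //.
    by split=> [v w|q v]; rewrite /= (Llin.1, Llin.2).
  by move=> b' Hb'; rewrite -hH //; exact: Sh.
have S2 y : H y -> S (0, y).
  move=> /uS[x nx <-]; have := rat_spanB (Sh x) (SL x); rewrite hC //.
  by congr S; congr pair; rewrite /= ?subrr // addrC addKr.
have S2T y : S (0, y).
  apply: (@rat_span_ind R R^o (R^o * R^o)%type H _ (fun y => (0, y))) => //.
  by split=> [v w|q v]; congr pair; rewrite /= ?addr0 ?scaler0.
split=> //; have := rat_spanB (Sh b) (S2T (h b)).
by congr S; congr pair; rewrite /= ?subr0 ?subrr.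
Qed.

End HamelFunctions.

(** * The factorization of [g] *)

Theorem corollary2 (R : realType) (g : R -> R)
  (hg : exists H : set R, Hamel_basis H /\
          exists c : R, forall x : R, (H `|` [set 0]) x -> g x = c) :
  exists f h : R -> R, [/\ Hamel_function f, Hamel_function h & g = h \o f].
Proof.
have [H [Hbasis [c gc]]] := hg.
have [k Hk] := infinite_setN0 (Hamel_basis_infinite Hbasis).
have [||beta betaP] := @card_eq_set_bij _ _ (~` (H `|` [set 0])) (H `\ k).
- apply: infinite_setN0 (infinite_setD _ (finite_set1 k)).
  exact: Hamel_basis_infinite Hbasis.
- by rewrite (card_eqr (card_setD1_Hamel Hbasis k)); exact: card_setC_Hamel.
have [||u uP] := @card_eq_set_bij _ _ (~` H) H; first by exists k.
  by apply: card_setC_Hamel => //; exact: subsetUl.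
have [betaH betaI betaS] := betaP.
(* [gamma] inverts [beta]; away from [H] minus [k] its value is arbitrary. *)
have /choice[gamma gammaP] : forall y, exists x,
    (H `\ k) y -> ~ (H `|` [set 0]) x /\ beta x = y.
  move=> y; have [/betaS[x nx <-]|] := pselect ((H `\ k) y); last by exists 0.
  by exists x.
(* These values are forced by [g = h \o f], as [h] is to equal [L] on [H]: [k] is the image under
   [f] of the points where [g] is [c], and any other [y] in [H] is the image of [gamma y] only. *)
have [L [Llin LH]] := @rat_basis_extend R R^o R^o H
  (fun y => if pselect (y = k) then c else g (gamma y)) Hbasis.
pose f x := if pselect ((H `|` [set 0]) x) then k else beta x.
pose h x := if pselect (H x) then L x else L x + u x.
have fk x : (H `|` [set 0]) x -> f x = k by rewrite /f; case: pselect.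
have fC x : ~ (H `|` [set 0]) x -> f x = beta x by rewrite /f; case: pselect.
have hH x : H x -> h x = L x by rewrite /h; case: pselect.
have hC x : ~ H x -> h x = L x + u x by rewrite /h; case: pselect.
exists f, h; split.
- exact: (Hamel_function_collapse Hbasis Hk betaP).
- exact: (Hamel_function_shear Hbasis Llin uP).
- apply/funext => x /=; have [Hx|nx] := pselect ((H `|` [set 0]) x).
    by rewrite fk // hH // LH // gc //; case: pselect.
  have [Hb bk] := betaH _ nx; rewrite fC // hH // LH //.
  case: pselect => //= _; have [//|ng bg] := gammaP (beta x).
  by congr g; apply/esym/betaI; rewrite ?inE.
Qed.
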